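(* Let $\mathbf{X}\in\mathbb{R}^{m\times n}$, fix $p$ with $0<p<1$, and for each positive integer $d$ define $\theta(d)=\dfrac{p}{d-(d-1)p}$. Consider the problem $$\min_{d,\mathbf{U},\mathbf{V}}\ \mathbb{E}_{\mathbf{r}}\left\|\mathbf{X}-\tfrac{1}{\theta(d)}\mathbf{U}\,\mathrm{diag}(\mathbf{r})\,\mathbf{V}^\top\right\|_F^2,$$ over positive integers $d$, $\mathbf{U}\in\mathbb{R}^{m\times d}$, $\mathbf{V}\in\mathbb{R}^{n\times d}$, where $\mathbf{r}\in\mathbb{R}^d$ has i.i.d. $\mathrm{Bernoulli}(\theta(d))$ entries. Let $\mathbf{U}^{\rm opt}\in\mathbb{R}^{m\times d^{\rm opt}}$, $\mathbf{V}^{\rm opt}\in\mathbb{R}^{n\times d^{\rm opt}}$ attain the global optimum of this problem. Then $\mathbf{A}^{\rm opt}=\mathbf{U}^{\rm opt}(\mathbf{V}^{\rm opt})^\top$ is the global minimizer over $\mathbf{A}\in\mathbb{R}^{m\times n}$ of $$\|\mathbf{X}-\mathbf{A}\|_F^2+\frac{1-p}{p}\|\mathbf{A}\|_\star^2.$$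
   Context: $\|\cdot\|_F$ is the Frobenius norm, $\|\cdot\|_\star$ the nuclear norm (sum of singular values), $\mathrm{diag}(\mathbf{r})$ the diagonal matrix with diagonal $\mathbf{r}$, and $\mathbb{E}_{\mathbf{r}}$ the expectation with respect to $\mathbf{r}$. *)

(* Defs.v *)
From mathcomp Require Import all_boot all_order all_algebra.
From mathcomp Require Import polyrcf.
From mathcomp Require Import reals.
Set Implicit Arguments. Unset Strict Implicit. Unset Printing Implicit Defensive.
Import Order.TTheory GRing.Theory Num.Theory.
Local Open Scope ring_scope.

Section Defs.
Variable R : realType.

Definition frob2 m n (A : 'M[R]_(m, n)) : R := \sum_i \sum_j (A i j) ^+ 2.

(* nuclear norm: sum of singular values, i.e. of the square roots of the
   eigenvalues (with algebraic multiplicity) of A^T A; the eigenvalues are the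
   (real, nonnegative) roots of the characteristic polynomial of A^T A. *)
Definition nuclear m n (A : 'M[R]_(m, n)) : R :=
  let q := char_poly (A^T *m A) in
  \sum_(x <- rootsR q) (mup x q)%:R * Num.sqrt x.

Definition theta (p : R) (d : nat) : R := p / (d%:R - (d%:R - 1) * p).

(* E_r || X - (1/theta(d)) U diag(r) V^T ||_F^2, r in {0,1}^d with i.i.d.
   Bernoulli(theta(d)) entries: the expectation is the finite weighted sum. *)
Definition dropout_obj (p : R) m n d (X : 'M[R]_(m, n))
    (U : 'M[R]_(m, d)) (V : 'M[R]_(n, d)) : R :=
  let t := theta p d in
  \sum_(r : {ffun 'I_d -> bool})
     (\prod_(i < d) (if r i then t else 1 - t)) *
     frob2 (X - t^-1 *: (U *m diag_mx (\row_i (r i)%:R) *m V^T)).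

Definition reg_obj (p : R) m n (X A : 'M[R]_(m, n)) : R :=
  frob2 (X - A) + (1 - p) / p * (nuclear A) ^+ 2.

End Defs.

(* Main.v *)
Require Import Defs.
From mathcomp Require Import all_boot all_order all_algebra.
From mathcomp Require Import polyrcf reals.
From mathcomp Require Import complex ring lra.
Set Implicit Arguments. Unset Strict Implicit. Unset Printing Implicit Defensive.
Import Order.TTheory GRing.Theory Num.Theory.
Local Open Scope ring_scope.

(** Write u_k, v_k for the columns of U, V. Since 1/theta(d) - 1 = d (1 - p) / p,
    taking the expectation turns the dropout objective into
      |X - U V^T|_F^2 + (1 - p)/p * d * sum_k |u_k|^2 |v_k|^2.
    By Cauchy-Schwarz d * sum_k |u_k|^2 |v_k|^2 >= (sum_k |u_k| |v_k|)^2, and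
    sum_k |u_k| |v_k| >= |U V^T|_*, so it dominates the regularized objective
    at U V^T. Conversely, from a singular value decomposition A = P S Q^T and a
    W with orthonormal rows and entries +-1/sqrt d (rows of a Hadamard matrix),
    the factors P S^(1/2) W and Q S^(1/2) W of A have all their columns of squared
    norm |A|_*/d, and both inequalities become equalities. Hence U^opt (V^opt)^T
    minimizes the regularized objective, and uniqueness follows from strict
    convexity. *)

(** * Spectral theorem for real symmetric matrices *)

Lemma sqnorm_rv_eq0 (R : realDomainType) n (x : 'rV[R]_n) :
  ((x *m x^T) 0 0 == 0) = (x == 0).
Proof.
rewrite mxE psumr_eq0 => [|i _]; last by rewrite mxE -expr2 sqr_ge0.
apply/allP/eqP => [h|-> i _]; last by rewrite !mxE mul0r eqxx.
apply/rowP => i; move/(_ i): h; rewrite mem_index_enum mxE mulf_eq0 orbb mxE.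
by move=> /(_ isT)/eqP.
Qed.

(** A complex eigenvector x + iy with eigenvalue a + ib exists over the algebraic closure. Computing
    x A y^T in two ways gives b (|x|^2 + |y|^2) = 0, so b = 0, and whichever of x, y is nonzero is a
    real eigenvector for a. *)
Lemma symmetric_eigenvector (R : rcfType) n (A : 'M[R]_n.+1) : A^T = A ->
  exists a, exists2 v : 'rV[R]_n.+1, v != 0 & v *m A = a *: v.
Proof.
move=> symA; set AC := map_mx (real_complex R) A.
have [z] : exists z, root (char_poly AC) z.
  by apply/closed_rootP; rewrite size_char_poly.
rewrite -eigenvalue_root_char => /eigenvalueP[v vA v0].
pose x := map_mx (@complex.Re R) v; pose y := map_mx (@complex.Im R) v.
case: z vA => a b vA.
have e j : (x *m A) 0 j = a * x 0 j - b * y 0 j /\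
           (y *m A) 0 j = a * y 0 j + b * x 0 j.
  have := congr1 (fun M : 'rV[R[i]]_n.+1 => M 0 j) vA; rewrite !mxE.
  under eq_bigr do rewrite mxE.
  have -> : \sum_k v 0 k * real_complex R (A k j) =
      ((\sum_k x 0 k * A k j) +i* (\sum_k y 0 k * A k j))%C.
    elim: (index_enum _) => [|k s IHs]; first by rewrite !big_nil.
    by rewrite !big_cons IHs !mxE; case: (v 0 k) => p q; simpc.
  case: (v 0 j) => p q; simpc => -[-> ->].
  by split.
have ex : x *m A = a *: x - b *: y by apply/rowP => j; rewrite (e j).1 !mxE.
have ey : y *m A = a *: y + b *: x by apply/rowP => j; rewrite (e j).2 !mxE.
have xy0 : (x != 0) || (y != 0).
  rewrite -negb_and; apply: contra v0 => /andP[/eqP x0 /eqP y0].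
  apply/eqP/rowP => j; apply/eqP; rewrite eq_complex !mxE /=.
  move/rowP/(_ j): x0; move/rowP/(_ j): y0; rewrite !mxE => -> ->.
  by rewrite eqxx.
have b0 : b = 0.
  have : x *m A *m y^T = (y *m A *m x^T)^T.
    by rewrite !trmx_mul trmxK symA mulmxA.
  rewrite ex ey mulmxBl mulmxDl linearD /= -!scalemxAl !linearZ /=.
  rewrite !trmx_mul !trmxK => eb.
  have /eqP : b * ((x *m x^T) 0 0 + (y *m y^T) 0 0) = 0.
    move: eb; move: (x *m x^T) (y *m y^T) (x *m y^T) => s t u.
    by move=> /(congr1 (fun M : 'M_1 => M 0 0)); rewrite !mxE; lra.
  rewrite mulf_eq0 => /orP[/eqP//|].
  have ge0 (w : 'rV[R]_n.+1) : 0 <= (w *m w^T) 0 0.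
    by rewrite mxE sumr_ge0 // => i _; rewrite mxE -expr2 sqr_ge0.
  rewrite paddr_eq0 // !sqnorm_rv_eq0 => /andP[x0 y0].
  by move: xy0; rewrite x0 y0.
exists a; have [x0|] := boolP (x == 0); last first.
  by exists x => //; rewrite ex b0 scale0r subr0.
by move: xy0; rewrite x0 /= => y0; exists y => //; rewrite ey b0 scale0r addr0.
Qed.

(** The reflection in the hyperplane orthogonal to w = v - e swaps e and v, which have equal length;
    when w = 0 the identity does. *)
Lemma householder (R : rcfType) n (v : 'rV[R]_n) (e : 'rV[R]_n) :
  (v *m v^T) 0 0 = 1 -> (e *m e^T) 0 0 = 1 ->
  exists2 H : 'M[R]_n, H *m H^T = 1%:M & e *m H = v.
Proof.
move=> v1 e1; have [w wE] : exists w, w = v - e by exists (v - e).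
have [/eqP|w0] := boolP (w == 0).
  by rewrite wE => /subr0_eq ->; exists 1%:M; rewrite ?mulmx1 ?trmx1 ?mulmx1.
pose N := (w *m w^T) 0 0; have N0 : N != 0 by rewrite sqnorm_rv_eq0.
have wwE : w *m w^T = N%:M by apply: mx11_scalar.
pose H : 'M[R]_n := 1%:M - (2 / N) *: (w^T *m w).
have HT : H^T = H by rewrite /H linearB /= linearZ /= trmx1 trmx_mul trmxK.
exists H.
  rewrite HT /H mulmxBl mul1mx mulmxBr mulmx1 -!scalemxAl -!scalemxAr.
  rewrite mulmxA -(mulmxA w^T) wwE mul_mx_scalar -scalemxAl !scalerA.
  by rewrite divfK // mulr_natr mulr2n scalerDl opprB addrK subrK.
rewrite /H mulmxBr mulmx1 -scalemxAr mulmxA (mx11_scalar (e *m w^T)).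
rewrite mul_scalar_mx scalerA.
suff -> : 2 / N * (e *m w^T) 0 0 = -1 by rewrite scaleN1r opprK wE addrC subrK.
have tE : (v *m e^T) 0 0 = (e *m v^T) 0 0.
  by rewrite !mxE; apply: eq_bigr => i _; rewrite !mxE mulrC.
(* For unit vectors, |v - e|^2 = 2 - 2 <e, v> = -2 <e, v - e>. *)
have NE : N = - (2 * (e *m w^T) 0 0).
  rewrite /N wE linearB /= !mulmxBl !mulmxBr.
  rewrite ![(_ + _ : 'M_1) 0 0]mxE ![(- _ : 'M_1) 0 0]mxE.
  by rewrite ![(_ + _ : 'M_1) 0 0]mxE ![(- _ : 'M_1) 0 0]mxE tE v1 e1; ring.
by apply: (mulfI N0); rewrite mulrA mulrCA divff // mulr1 mulrN1 NE opprK; ring.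
Qed.

(** Deflation: conjugating by a reflection that sends the first basis vector to a unit eigenvector
    leaves a 1 x 1 block and a smaller symmetric block, to which induction applies. *)
Theorem symmetric_spectral (R : rcfType) n (A : 'M[R]_n) : A^T = A ->
  exists2 Q : 'M[R]_n, Q^T *m Q = 1%:M &
  exists mu : 'rV[R]_n, Q^T *m A *m Q = diag_mx mu.
Proof.
elim: n A => [|n IHn] A symA.
  by exists 1%:M; rewrite ?trmx1 ?mulmx1 //; exists 0; apply/matrixP => -[].
have [a [v0 v0n0 v0A]] := symmetric_eigenvector symA.
pose N := (v0 *m v0^T) 0 0.
have Ngt0 : 0 < N.
  rewrite lt0r sqnorm_rv_eq0 v0n0 /N mxE sumr_ge0 // => i _.
  by rewrite mxE -expr2 sqr_ge0.
pose v := (Num.sqrt N)^-1 *: v0.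
have vA : v *m A = a *: v by rewrite -scalemxAl v0A !scalerA mulrC.
have v1 : (v *m v^T) 0 0 = 1.
  rewrite /v linearZ /= -scalemxAl -scalemxAr scalerA mxE -/N.
  by rewrite -invfM -expr2 sqr_sqrtr ?ltW // mulVf ?gt_eqF.
pose e : 'rV[R]_n.+1 := delta_mx 0 0.
have e1 : (e *m e^T) 0 0 = 1 by rewrite trmx_delta mul_delta_mx mxE !eqxx.
have [H HH eH] := householder v1 e1.
have [B defB] : exists B : 'M_(1 + n), B = H *m A *m H^T by exists (H *m A *m H^T).
have BT : B^T = B by rewrite defB !trmx_mul trmxK symA mulmxA.
have eB : e *m B = a *: e.
  rewrite defB !mulmxA eH vA -scalemxAl; congr (_ *: _).
  by rewrite -eH -mulmxA HH mulmx1.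
(* [eB] determines the first row of [B]; the first column follows by symmetry. *)
have B0 (i j : 'I_(1 + n)) : i = 0%N :> nat -> B i j = a *+ (j == 0%N :> nat).
  move=> i0; have -> : i = 0 :> 'I_n.+1 by apply: val_inj.
  have := congr1 (fun M : 'rV[R]_n.+1 => M 0 j) eB.
  by rewrite -rowE !mxE eqxx /= => ->; rewrite mulr_natr.
pose C := drsubmx B.
have BE : B = block_mx a%:M 0 0 C.
  rewrite -[LHS](@submxK R 1 n 1 n); congr block_mx.
  - by apply/matrixP => i j; rewrite !ord1 !mxE B0.
  - by apply/matrixP => i j; rewrite !ord1 !mxE B0.
  - by apply/matrixP => i j; rewrite !ord1 !mxE -BT mxE B0.
have CT : C^T = C by rewrite /C trmx_drsub BT.
have [Q QQ [mu QC]] := IHn C CT.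
pose K : 'M_(1 + n) := block_mx 1%:M 0 0 Q.
have KK : K^T *m K = 1%:M.
  rewrite tr_block_mx !trmx0 trmx1 mulmx_block !mulmx0 !mul0mx mulmx1 QQ.
  by rewrite !addr0 add0r -scalar_mx_block.
have KB : K^T *m B *m K = diag_mx (row_mx (a%:M : 'M_1) mu).
  rewrite BE tr_block_mx !trmx0 trmx1 !mulmx_block !mulmx0 !mul0mx !mulmx1.
  rewrite !mul1mx !addr0 !add0r !mul0mx QC diag_mx_row.
  by congr block_mx; apply/matrixP => i j; rewrite !ord1 !mxE.
exists (H^T *m K).
  by rewrite trmx_mul trmxK -mulmxA (mulmxA H) HH mul1mx.
by exists (row_mx (a%:M : 'M_1) mu); rewrite -KB defB trmx_mul trmxK !mulmxA.
Qed.

(** * The dropout expectation *)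

Section Bernoulli.
Variables (R : comNzRingType) (d : nat) (t : R).

Definition bernoulli_weight (r : {ffun 'I_d -> bool}) : R :=
  \prod_(i < d) (if r i then t else 1 - t).

(** Independence, obtained by distributing a product over sums. The moments below come from a [g]
    equal to 1 away from the coordinates of interest. *)
Lemma bernoulli_expect_prod (g : 'I_d -> bool -> R) :
  \sum_r bernoulli_weight r * \prod_i g i (r i) =
  \prod_i (t * g i true + (1 - t) * g i false).
Proof.
transitivity (\prod_(i < d) \sum_(b : bool) ((if b then t else 1 - t) * g i b)).
  rewrite bigA_distr_bigA; apply: eq_bigr => r _.
  by rewrite /bernoulli_weight -big_split.
by apply: eq_bigr => i _; rewrite big_bool.
Qed.

Lemma bernoulli_weight_sum : \sum_r bernoulli_weight r = 1.
Proof.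
transitivity (\sum_r bernoulli_weight r * \prod_(i < d) 1).
  by apply: eq_bigr => r _; rewrite big1_eq mulr1.
by rewrite (bernoulli_expect_prod (fun _ _ => 1)) big1 // => i _; ring.
Qed.

Lemma bernoulli_expect1 (z : bool -> R) k :
  \sum_r bernoulli_weight r * z (r k) = t * z true + (1 - t) * z false.
Proof.
have := bernoulli_expect_prod (fun i b => if i == k then z b else 1).
rewrite [RHS](bigD1 k) //= eqxx [X in _ * X]big1 ?mulr1 => [<-|i /negPf->].
  apply: eq_bigr => r _; rewrite (bigD1 k) //= eqxx big1 ?mulr1 //.
  by move=> i /negPf->.
ring.
Qed.

Lemma bernoulli_expect2_neq (z : bool -> R) k l : k != l ->
  t * z true + (1 - t) * z false = 0 ->
  \sum_r bernoulli_weight r * (z (r k) * z (r l)) = 0.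
Proof.
move=> kl z0; have lk : l != k by rewrite eq_sym.
have := bernoulli_expect_prod
  (fun i b => if (i == k) || (i == l) then z b else 1).
rewrite [RHS](bigD1 k) //= eqxx z0 mul0r => e; rewrite -[RHS]e.
apply: eq_bigr => r _; rewrite (bigD1 k) //= eqxx (bigD1 l) //= eqxx orbT.
by rewrite big1 ?mulr1 // => i /andP[/negPf-> /negPf->].
Qed.

(** Bias-variance decomposition: the [z (r k)] are centered and independent, so the linear term and
    the off-diagonal products average to zero. *)
Lemma bernoulli_expect_sqr (z : bool -> R) (x : R) (c : 'I_d -> R) :
  t * z true + (1 - t) * z false = 0 ->
  \sum_r bernoulli_weight r * (x - \sum_k c k * z (r k)) ^+ 2 =
  x ^+ 2 + (t * z true ^+ 2 + (1 - t) * z false ^+ 2) * \sum_k c k ^+ 2.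
Proof.
move=> z0.
have e r : bernoulli_weight r * (x - \sum_k c k * z (r k)) ^+ 2 =
  x ^+ 2 * bernoulli_weight r
  - \sum_k (2 * x * c k) * (bernoulli_weight r * z (r k))
  + \sum_k \sum_l c k * c l * (bernoulli_weight r * (z (r k) * z (r l))).
  set S := \sum_k c k * z (r k).
  have -> : \sum_k (2 * x * c k) * (bernoulli_weight r * z (r k)) =
     2 * x * bernoulli_weight r * S.
    by rewrite mulr_sumr; apply: eq_bigr => k _; ring.
  have -> : \sum_k \sum_l c k * c l * (bernoulli_weight r * (z (r k) * z (r l)))
     = bernoulli_weight r * (S * S).
    rewrite {1}/S mulr_suml mulr_sumr; apply: eq_bigr => k _.
    rewrite /S mulr_sumr mulr_sumr; apply: eq_bigr => l _; ring.
  ring.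
under eq_bigr do rewrite e.
rewrite !big_split /= -mulr_sumr bernoulli_weight_sum mulr1 sumrN exchange_big /=.
rewrite [X in _ - X]big1 ?subr0 => [|k _]; last first.
  rewrite -[RHS](mulr0 (2 * x * c k)) -{2}z0 -(bernoulli_expect1 z k).
  by rewrite [RHS]mulr_sumr.
congr (_ + _); rewrite exchange_big /= mulr_sumr; apply: eq_bigr => k _.
rewrite exchange_big /= (bigD1 k) //= [X in _ + X]big1 => [|l lk]; last first.
  have kl : k != l by rewrite eq_sym.
  rewrite -[RHS](mulr0 (c k * c l)) -[X in _ = _ * X](bernoulli_expect2_neq kl z0).
  by rewrite [RHS]mulr_sumr.
have := bernoulli_expect1 (fun b => z b * z b) k.
rewrite addr0 -!expr2 => <-; rewrite mulr_suml; apply: eq_bigr => r _; ring.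
Qed.

End Bernoulli.

Lemma theta_gt0 (R : realType) (p : R) d : 0 < p -> p < 1 -> 0 < theta p d.
Proof.
move=> p0 p1; rewrite /theta divr_gt0 //.
have : 0 <= d%:R * (1 - p) by rewrite mulr_ge0 // subr_ge0 ltW.
lra.
Qed.

(** This explains the choice of [theta]: the noise variance is proportional to d, the very factor
    that Cauchy-Schwarz over d columns costs. *)
Lemma theta_odds (R : realType) (p : R) d : 0 < p -> p < 1 ->
  (theta p d)^-1 - 1 = d%:R * ((1 - p) / p).
Proof.
move=> p0 p1; have p0' : p != 0 by rewrite gt_eqF.
rewrite /theta invf_div; field.
by [].
Qed.

(** * Closed form of the dropout objective *)

Section Factorization.
Variable R : realType.

Definition colnorm2 m d (U : 'M[R]_(m, d)) (k : 'I_d) : R := \sum_i U i k ^+ 2.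

Lemma colnorm2_ge0 m d (U : 'M[R]_(m, d)) k : 0 <= colnorm2 U k.
Proof. by rewrite sumr_ge0 // => i _; rewrite sqr_ge0. Qed.

Lemma colnorm2E m d (U : 'M[R]_(m, d)) k : colnorm2 U k = (U^T *m U) k k.
Proof. by rewrite mxE; apply: eq_bigr => i _; rewrite mxE expr2. Qed.

Lemma colnorm2Z m d a (U : 'M[R]_(m, d)) k :
  colnorm2 (a *: U) k = a ^+ 2 * colnorm2 U k.
Proof. by rewrite /colnorm2 mulr_sumr; apply: eq_bigr => i _; rewrite mxE exprMn. Qed.

Lemma dropout_objE (p : R) m n d (X : 'M[R]_(m, n)) (U : 'M[R]_(m, d))
    (V : 'M[R]_(n, d)) : 0 < p -> p < 1 ->
  dropout_obj p X U V = frob2 (X - U *m V^T) +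
    (1 - p) / p * (d%:R * \sum_k colnorm2 U k * colnorm2 V k).
Proof.
move=> p0 p1; rewrite /dropout_obj; set t := theta p d.
have t0 : t != 0 by rewrite gt_eqF ?theta_gt0.
(* The centered noise, of variance 1/t - 1: each entry of the residual is that of X - U V^T minus a
   linear form in the [z (r k)]. *)
pose z (b : bool) : R := b%:R / t - 1.
have z0 : t * z true + (1 - t) * z false = 0 by rewrite /z /=; field.
have z2 : t * z true ^+ 2 + (1 - t) * z false ^+ 2 = t^-1 - 1.
  by rewrite /z /=; field.
have entry (r : {ffun 'I_d -> bool}) i j :
  (X - t^-1 *: (U *m diag_mx (\row_i (r i)%:R) *m V^T)) i j =
  (X - U *m V^T) i j - \sum_k (U i k * V j k) * z (r k).
  rewrite mul_mx_diag !mxE -addrA; congr (_ + _).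
  rewrite -opprD mulr_sumr -big_split; congr (- _); apply: eq_bigr => k _ /=.
  by rewrite !mxE /z; ring.
transitivity (\sum_i \sum_j \sum_r bernoulli_weight t r *
  ((X - U *m V^T) i j - \sum_k (U i k * V j k) * z (r k)) ^+ 2).
  rewrite /frob2; under eq_bigr do rewrite mulr_sumr.
  rewrite exchange_big; apply: eq_bigr => i _ /=.
  under eq_bigr do rewrite mulr_sumr.
  rewrite exchange_big; apply: eq_bigr => j _ /=.
  by apply: eq_bigr => r _; rewrite entry.
under eq_bigr do under eq_bigr do rewrite bernoulli_expect_sqr // z2.
rewrite /frob2; under eq_bigr do rewrite big_split /=.
rewrite big_split /=; congr (_ + _).
under [LHS]eq_bigr do rewrite -mulr_sumr.
rewrite -mulr_sumr theta_odds // [RHS]mulrA [_ * d%:R]mulrC; congr (_ * _).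
under [LHS]eq_bigr do rewrite exchange_big /=.
rewrite exchange_big /=; apply: eq_bigr => k _.
rewrite /colnorm2 mulr_suml; apply: eq_bigr => i _.
by rewrite mulr_sumr; apply: eq_bigr => j _; rewrite exprMn.
Qed.

End Factorization.

(** * Nuclear norm and singular values *)

(** Lagrange's identity: the sum of the squares of x_i y_j - x_j y_i is twice the gap. *)
Lemma sum_sqr_Cauchy (R : realDomainType) (I : finType) (x y : I -> R) :
  (\sum_i x i * y i) ^+ 2 <= (\sum_i x i ^+ 2) * (\sum_i y i ^+ 2).
Proof.
have : 0 <= \sum_i \sum_j (x i * y j - x j * y i) ^+ 2.
  by apply: sumr_ge0 => i _; apply: sumr_ge0 => j _; rewrite sqr_ge0.
set S := \sum_i \sum_j _.
have -> : S = (\sum_i x i ^+ 2) * (\sum_i y i ^+ 2) *+ 2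
             - (\sum_i x i * y i) ^+ 2 *+ 2.
  rewrite mulr2n {2}[(\sum_i x i ^+ 2) * _]mulrC expr2 !mulr_suml -sumrMnl.
  rewrite -sumrN -!big_split /=; apply: eq_bigr => i _.
  rewrite !mulr_sumr -sumrMnl -sumrN -!big_split /=; apply: eq_bigr => j _.
  ring.
by rewrite -mulrnBl pmulrn_lge0 // subr_ge0.
Qed.

Lemma sum_Cauchy (R : rcfType) (I : finType) (x y : I -> R) :
  \sum_i x i * y i <= Num.sqrt (\sum_i x i ^+ 2) * Num.sqrt (\sum_i y i ^+ 2).
Proof.
have x0 : 0 <= \sum_i x i ^+ 2 by apply: sumr_ge0 => i _; rewrite sqr_ge0.
rewrite -sqrtrM // (le_trans (ler_norm _)) // -sqrtr_sqr ler_wsqrtr //.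
exact: sum_sqr_Cauchy.
Qed.

(** Turns the sum over distinct roots in [nuclear] into a sum over a list of eigenvalues: the
    multiplicity of a root is its number of occurrences in [s]. *)
Lemma sum_rootsR_mup (R : rcfType) (s : seq R) (f : R -> R) :
  let q := \prod_(y <- s) ('X - y%:P) in
  \sum_(x <- rootsR q) (mup x q)%:R * f x = \sum_(y <- s) f y.
Proof.
move=> q; have q0 : q != 0 by apply/monic_neq0/monic_prod_XsubC.
rewrite -[RHS]big_undup_iterop_count /= (perm_big (undup s)) /=.
  apply: eq_bigr => x _; rewrite mu_prod_XsubC mulr_natl.
  by case: (count_mem x s) => [|k]; rewrite ?mulr0n // -Monoid.iteropE.
apply: uniq_perm; rewrite ?undup_uniq ?uniq_roots // => x.
rewrite mem_undup -[RHS]root_prod_XsubC.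
by have /roots_onP h := roots_on_rootsR q0; rewrite -/q h ?inE.
Qed.

Lemma char_poly_conj (R : comNzRingType) n (P M Q : 'M[R]_n) :
  P *m Q = 1%:M -> char_poly (P *m M *m Q) = char_poly M.
Proof.
move=> PQ; rewrite /char_poly /char_poly_mx !map_mxM /=.
set P' := map_mx _ P; set Q' := map_mx _ Q; set M' := map_mx _ M.
have PQ' : P' *m Q' = 1%:M by rewrite -map_mxM PQ map_mx1.
have -> : 'X%:M - P' *m M' *m Q' = P' *m ('X%:M - M') *m Q'.
  by rewrite mulmxBr mulmxBl mul_mx_scalar -scalemxAl PQ' scalemx1.
by rewrite !det_mulmx mulrAC -det_mulmx PQ' det1 mul1r.
Qed.

Lemma nuclear_orthodiag (R : realType) m n (A : 'M[R]_(m, n)) (Q : 'M[R]_n) mu :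
  Q^T *m Q = 1%:M -> Q^T *m (A^T *m A) *m Q = diag_mx mu ->
  nuclear A = \sum_i Num.sqrt (mu 0 i).
Proof.
move=> QQ AE; rewrite /nuclear.
have -> : char_poly (A^T *m A) = \prod_(y <- [seq mu 0 i | i <- enum 'I_n]) ('X - y%:P).
  rewrite big_map big_enum /=.
  have -> : char_poly (A^T *m A) = char_poly (diag_mx mu).
    by rewrite -AE char_poly_conj.
  rewrite char_poly_trig ?diag_mx_is_trig //.
  by apply: eq_bigr => i _; rewrite mxE eqxx.
by rewrite sum_rootsR_mup big_map big_enum.
Qed.

Lemma colnorm2_eq0 (R : realType) m d (U : 'M[R]_(m, d)) i k :
  colnorm2 U k = 0 -> U i k = 0.
Proof.
move/eqP; rewrite psumr_eq0 => [|l _]; last by rewrite sqr_ge0.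
by move/allP/(_ i); rewrite mem_index_enum sqrf_eq0 => /(_ isT)/eqP.
Qed.

(** [Q] diagonalizes A^T A, and the columns of [P] are the normalized columns of A Q, or zero where
    the singular value is zero. Letting [P] be only a partial isometry spares completing it to an
    orthonormal family, impossible when m < n. *)
Lemma svd (R : realType) m n (A : 'M[R]_(m, n)) :
  exists P : 'M[R]_(m, n), exists Q : 'M[R]_n, exists s : 'rV[R]_n,
  [/\ Q^T *m Q = 1%:M, A *m Q = P *m diag_mx s,
      P^T *m P = diag_mx (\row_i (s 0 i != 0)%:R),
      forall i, 0 <= s 0 i & nuclear A = \sum_i s 0 i].
Proof.
have symA : (A^T *m A)^T = A^T *m A by rewrite trmx_mul trmxK.
have [Q QQ [mu AE]] := symmetric_spectral symA.
have mu0 i : 0 <= mu 0 i.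
  have -> : mu 0 i = colnorm2 (A *m Q) i.
    by rewrite colnorm2E trmx_mul !mulmxA -(mulmxA Q^T) AE mxE eqxx.
  exact: colnorm2_ge0.
pose s : 'rV[R]_n := \row_i Num.sqrt (mu 0 i).
have s2 i : s 0 i ^+ 2 = mu 0 i by rewrite mxE sqr_sqrtr.
have AQ : (A *m Q)^T *m (A *m Q) = diag_mx mu.
  by rewrite trmx_mul !mulmxA -(mulmxA Q^T) AE.
(* the columns of [P] with [s i = 0] vanish, since [0^-1 = 0] *)
exists (A *m Q *m diag_mx (\row_i (s 0 i)^-1)), Q, s.
move: (A *m Q) AQ => B BB; split => //.
- rewrite -mulmxA mulmx_diag; apply/matrixP => i j; rewrite mul_mx_diag !mxE.
  have [s0|s0] := eqVneq (Num.sqrt (mu 0 j)) 0; last by rewrite mulVf // mulr1.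
  (* Column j of A Q has squared norm [mu 0 j] = 0, so it vanishes. *)
  rewrite s0 !mulr0; apply: colnorm2_eq0.
  by rewrite colnorm2E BB mxE eqxx -s2 mxE s0 expr0n.
- rewrite trmx_mul tr_diag_mx -mulmxA (mulmxA _^T) BB !mulmx_diag.
  congr diag_mx; apply/rowP => i; rewrite !mxE.
  have [->|s0] := eqVneq (Num.sqrt (mu 0 i)) 0; first by rewrite invr0 !mul0r ?eqxx.
  move: (s2 i) s0; rewrite mxE; move: (Num.sqrt _) => t <- t0 /=.
  by rewrite expr2 mulfK // mulVf.
- by move=> i; rewrite mxE sqrtr_ge0.
- by rewrite (nuclear_orthodiag QQ AE); apply: eq_bigr => i _; rewrite mxE.
Qed.

Lemma nuclear_ge0 (R : realType) m n (A : 'M[R]_(m, n)) : 0 <= nuclear A.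
Proof. by have [P [Q [s [_ _ _ s0 ->]]]] := svd A; rewrite sumr_ge0. Qed.

(** The hypothesis makes P P^T an orthogonal projection, so |u - P P^T u|^2 = |u|^2 - |P^T u|^2. It
    holds for both factors [P] and [Q] given by [svd]. *)
Lemma Bessel (R : realType) m r d (P : 'M[R]_(m, r)) (U : 'M[R]_(m, d)) k :
  P *m (P^T *m P) = P -> \sum_i (P^T *m U) i k ^+ 2 <= colnorm2 U k.
Proof.
move=> PP; rewrite -[leLHS]/(colnorm2 (P^T *m U) k).
have := colnorm2_ge0 (U - P *m (P^T *m U)) k.
rewrite !colnorm2E [(U - _)^T]linearB /= mulmxBl !mulmxBr !trmx_mul trmxK.
rewrite -!mulmxA [P *m (P^T *m (P *m _))](_ : _ = P *m (P^T *m U)); last first.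
  by rewrite !mulmxA -(mulmxA P) PP.
by rewrite subrr subr0 [_ k k]mxE [X in _ + X]mxE subr_ge0.
Qed.

(** The nuclear norm is the trace of P^T U V^T Q, that is, the sum over k of <P^T u_k, Q^T v_k>;
    Cauchy-Schwarz and Bessel bound each term. *)
Lemma nuclear_factor_le (R : realType) m n d (U : 'M[R]_(m, d)) (V : 'M[R]_(n, d)) :
  nuclear (U *m V^T) <=
  \sum_k Num.sqrt (colnorm2 U k) * Num.sqrt (colnorm2 V k).
Proof.
have [P [Q [s [QQ AQ PP s0 ->]]]] := svd (U *m V^T).
have PPP : P *m (P^T *m P) = P.
  rewrite PP; apply/matrixP => i j; rewrite mul_mx_diag !mxE.
  have [sj|] := eqVneq (s 0 j) 0; last by rewrite mulr1.
  rewrite mulr0; apply/esym/colnorm2_eq0.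
  by rewrite colnorm2E PP !mxE sj !eqxx.
have sE i : s 0 i = \sum_k (P^T *m U) i k * (Q^T *m V) i k.
  have : P^T *m (U *m V^T *m Q) = diag_mx s.
    rewrite AQ mulmxA PP mulmx_diag; congr diag_mx; apply/rowP => j; rewrite !mxE.
    by have [->|] := eqVneq (s 0 j) 0; rewrite ?mulr0 ?mul1r.
  rewrite -mulmxA mulmxA => /(congr1 (fun M : 'M_n => M i i)).
  rewrite [RHS]mxE eqxx mulr1n mxE => <-; apply: eq_bigr => k _.
  by congr (_ * _); rewrite -[in LHS](trmxK Q) -trmx_mul mxE.
under eq_bigr do rewrite sE.
rewrite exchange_big; apply: ler_sum => k _ /=.
rewrite (le_trans (sum_Cauchy _ _)) // ler_pM ?sqrtr_ge0 // ler_wsqrtr //.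
  exact: Bessel.
by apply: Bessel; rewrite QQ mulmx1.
Qed.

(** Sylvester's doubling, normalized by 1/sqrt 2 at each step; starting from order 1 it reaches
    order 2^n, which is at least n. *)
Lemma hadamard (R : rcfType) n :
  exists2 d, (n <= d)%N & exists H : 'M[R]_d,
    [/\ (0 < d)%N, H *m H^T = 1%:M & forall i j, H i j ^+ 2 = d%:R^-1].
Proof.
elim: n => [|n [d nd [H [d0 HH Hij]]]].
  exists 1%N => //; exists 1%:M; split => //; first by rewrite trmx1 mulmx1.
  by move=> i j; rewrite !ord1 mxE invr1 expr1n.
exists (d + d)%N; first by rewrite -addn1 leq_add.
pose c : R := (Num.sqrt 2)^-1.
have c2 : c ^+ 2 = 2^-1 by rewrite exprVn sqr_sqrtr.
exists (c *: block_mx H H H (- H)); split; first by rewrite addn_gt0 d0.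
  rewrite linearZ /= -scalemxAl -scalemxAr scalerA -expr2 c2 tr_block_mx.
  rewrite mulmx_block linearN /= !mulmxN !mulNmx opprK HH subrr.
  rewrite -mulr2n -scaler_nat scale_block_mx !scaler0 scalerA mulVf ?pnatr_eq0 //.
  by rewrite scale1r -scalar_mx_block.
move=> i j; rewrite mxE exprMn c2.
have -> : (d + d)%:R^-1 = 2^-1 * d%:R^-1 :> R by rewrite -invfM addnn -mul2n natrM.
congr (_ * _).
by case: (split_ordP i) => i' ->; case: (split_ordP j) => j' ->;
  rewrite ?block_mxEul ?block_mxEur ?block_mxEdl ?block_mxEdr ?mxE ?sqrrN Hij.
Qed.

(** Such a [W] spreads weights evenly: every diagonal entry of W^T diag(s) W is the sum of the s_i
    divided by d. *)
Lemma balanced_isometry (R : rcfType) n :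
  exists d, exists W : 'M[R]_(n, d),
    [/\ (0 < d)%N, W *m W^T = 1%:M & forall i j, W i j ^+ 2 = d%:R^-1].
Proof.
have [d nd [H [d0 HH Hij]]] := hadamard R n.
pose f := widen_ord nd.
exists d, (rowsub f H); split => // [|i j]; last by rewrite mxE Hij.
apply/matrixP => i j; have := congr1 (fun M : 'M_d => M (f i) (f j)) HH.
by rewrite !mxE => <-; apply: eq_bigr => k _; rewrite !mxE.
Qed.

(** * Balanced factorizations and convexity *)

(** Both Gram matrices U^T U and V^T V equal W^T S W, whose diagonal is constant by the choice of
    [W]. *)
Lemma balanced_factorization (R : realType) m n (A : 'M[R]_(m, n)) :
  exists d, exists U : 'M[R]_(m, d), exists V : 'M[R]_(n, d),
  [/\ (0 < d)%N, A = U *m V^T, forall k, colnorm2 U k = nuclear A / d%:R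
    & forall k, colnorm2 V k = nuclear A / d%:R].
Proof.
have [P [Q [s [QQ AQ PP s0 ->]]]] := svd A.
have [d [W [d0 WW Wij]]] := balanced_isometry R n.
pose D := diag_mx (\row_i Num.sqrt (s 0 i)).
have DT : D^T = D by rewrite tr_diag_mx.
have DD : D *m D = diag_mx s.
  rewrite mulmx_diag; congr diag_mx; apply/rowP => i.
  by rewrite !mxE -expr2 sqr_sqrtr.
have norm k : (W^T *m diag_mx s *m W) k k = (\sum_i s 0 i) / d%:R.
  rewrite mul_mx_diag mxE mulr_suml; apply: eq_bigr => i _.
  by rewrite !mxE -(Wij i k); ring.
exists d, (P *m D *m W), (Q *m D *m W); split => // [|k|k].
- rewrite !trmx_mul DT !mulmxA -(mulmxA _ W) WW mulmx1 -(mulmxA P) DD -AQ.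
  by rewrite -mulmxA (mulmx1C QQ) mulmx1.
- rewrite colnorm2E !trmx_mul DT -(norm k); congr (fun_of_matrix _ k k).
  rewrite !mulmxA -(mulmxA _ P^T) PP -!mulmxA; congr (_ *m _).
  rewrite !mulmxA !mulmx_diag; congr (diag_mx _ *m _); apply/rowP => i.
  rewrite !mxE mulrAC -expr2 sqr_sqrtr //.
  (* P^T P is the identity only where s_i is nonzero; elsewhere the factor s_i vanishes anyway. *)
  by have [->|] := eqVneq (s 0 i) 0; rewrite ?mul0r ?mulr1.
- rewrite colnorm2E !trmx_mul DT -(norm k); congr (fun_of_matrix _ k k).
  by rewrite !mulmxA -(mulmxA _ Q^T) QQ mulmx1 -(mulmxA W^T D D) DD.
Qed.

(** With N the nuclear norm of A, equal columns give the penalty d * d * (N/d)^2 = N^2. *)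
Lemma dropout_obj_balanced (R : realType) (p : R) m n (X A : 'M[R]_(m, n)) :
  0 < p -> p < 1 -> exists d, exists U : 'M[R]_(m, d), exists V : 'M[R]_(n, d),
  (0 < d)%N /\ dropout_obj p X U V = reg_obj p X A.
Proof.
move=> p0 p1; have [d [U [V [d0 -> Uk Vk]]]] := balanced_factorization A.
exists d, U, V; split => //; rewrite dropout_objE // /reg_obj.
have d0' : d%:R != 0 :> R by rewrite pnatr_eq0 -lt0n.
congr (_ + _ * _).
under eq_bigr do rewrite Uk Vk.
by rewrite sumr_const card_ord -mulr_natl; field.
Qed.

Lemma reg_obj_le_dropout (R : realType) (p : R) m n d (X : 'M[R]_(m, n))
    (U : 'M[R]_(m, d)) (V : 'M[R]_(n, d)) : 0 < p -> p < 1 ->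
  reg_obj p X (U *m V^T) <= dropout_obj p X U V.
Proof.
move=> p0 p1; rewrite dropout_objE // /reg_obj lerD2l ler_wpM2l //.
  by rewrite divr_ge0 ?subr_ge0 ?ltW.
pose a k := Num.sqrt (colnorm2 U k) * Num.sqrt (colnorm2 V k).
have aE k : colnorm2 U k * colnorm2 V k = a k ^+ 2.
  by rewrite exprMn !sqr_sqrtr ?colnorm2_ge0.
under eq_bigr do rewrite aE.
have := nuclear_factor_le U V; rewrite -/(a _) => le_a.
apply: (@le_trans _ _ ((\sum_k a k) ^+ 2)).
  by rewrite lerXn2r ?nnegrE ?nuclear_ge0 // (le_trans (nuclear_ge0 _) le_a).
(* The constant vector 1 has squared norm d, the factor in the penalty. *)
have := sum_sqr_Cauchy (fun _ => 1) a.
have -> : \sum_k 1 * a k = \sum_k a k by apply: eq_bigr => k _; rewrite mul1r.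
by rewrite expr1n sumr_const card_ord.
Qed.

(* Stacking balanced factorizations of [A] and [B] side by side factors [A + B]. *)
Lemma nuclear_midpoint_le (R : realType) m n (A B : 'M[R]_(m, n)) :
  nuclear (2^-1 *: (A + B)) <= (nuclear A + nuclear B) / 2.
Proof.
have [d [U [V [d0 AE Uk Vk]]]] := balanced_factorization A.
have [e [S [T [e0 BE Sk Tk]]]] := balanced_factorization B.
have -> : 2^-1 *: (A + B) = (2^-1 *: row_mx U S) *m (row_mx V T)^T.
  by rewrite -scalemxAl tr_row_mx mul_row_col -AE -BE.
rewrite (le_trans (nuclear_factor_le _ _)) // big_split_ord /= mulrDl.
(* Only the left factor is halved, so each of the f columns of a block contributes N / (2 f). *)
have h (N : R) f : 0 <= N -> (0 < f)%N ->
    \sum_(k < f) Num.sqrt (2^-1 ^+ 2 * (N / f%:R)) * Num.sqrt (N / f%:R) = N / 2.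
  move=> N0 f0; have f0' : f%:R != 0 :> R by rewrite pnatr_eq0 -lt0n.
  have q0 : 0 <= N / f%:R by rewrite divr_ge0.
  rewrite sumr_const card_ord sqrtrM ?sqr_ge0 // sqrtr_sqr gtr0_norm ?invr_gt0 //.
  rewrite -mulrA -expr2 sqr_sqrtr // -mulr_natl; field.
  exact: f0'.
have eq1 k : colnorm2 (2^-1 *: row_mx U S) (lshift e k) = 2^-1 ^+ 2 * (nuclear A / d%:R).
  rewrite colnorm2Z -(Uk k); congr (_ * _).
  by apply: eq_bigr => i _; rewrite row_mxEl.
have eq2 k : colnorm2 (2^-1 *: row_mx U S) (rshift d k) = 2^-1 ^+ 2 * (nuclear B / e%:R).
  rewrite colnorm2Z -(Sk k); congr (_ * _).
  by apply: eq_bigr => i _; rewrite row_mxEr.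
have eq3 k : colnorm2 (row_mx V T) (lshift e k) = nuclear A / d%:R.
  by rewrite -(Vk k); apply: eq_bigr => i _; rewrite row_mxEl.
have eq4 k : colnorm2 (row_mx V T) (rshift d k) = nuclear B / e%:R.
  by rewrite -(Tk k); apply: eq_bigr => i _; rewrite row_mxEr.
rewrite -(h _ _ (nuclear_ge0 A) d0) -(h _ _ (nuclear_ge0 B) e0).
by rewrite lerD // le_eqVlt; apply/orP; left; apply/eqP/eq_bigr => k _;
  rewrite ?eq1 ?eq2 ?eq3 ?eq4.
Qed.

(** * Strict convexity of the regularized objective *)

Lemma frob2_midpoint (R : realType) m n (A B : 'M[R]_(m, n)) :
  frob2 (2^-1 *: (A + B)) =
  (frob2 A + frob2 B) / 2 - frob2 (2^-1 *: (A - B)).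
Proof.
rewrite /frob2 -big_split mulr_suml -sumrB; apply: eq_bigr => i _ /=.
rewrite -big_split mulr_suml -sumrB; apply: eq_bigr => j _ /=.
by rewrite !mxE; field.
Qed.

Lemma frob2_gt0 (R : realType) m n (A : 'M[R]_(m, n)) : A <> 0 -> 0 < frob2 A.
Proof.
move=> A0; have ge0 i : 0 <= \sum_j A i j ^+ 2.
  by apply: sumr_ge0 => j _; rewrite sqr_ge0.
rewrite lt0r sumr_ge0 // andbT; apply: contra_notN A0.
rewrite psumr_eq0 // => /allP h; apply/matrixP => i j; rewrite mxE.
have := h i; rewrite mem_index_enum psumr_eq0 => [/(_ isT)/allP/(_ j)|l _].
  by rewrite mem_index_enum sqrf_eq0 => /(_ isT)/eqP.
by rewrite sqr_ge0.
Qed.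

(** Strictness comes from the Frobenius term, through the parallelogram law; the squared nuclear
    norm contributes plain midpoint convexity. *)
Lemma reg_obj_midpoint_lt (R : realType) (p : R) m n (X A B : 'M[R]_(m, n)) :
  0 < p -> p < 1 -> A <> B ->
  reg_obj p X (2^-1 *: (A + B)) < (reg_obj p X A + reg_obj p X B) / 2.
Proof.
move=> p0 p1 AB; rewrite /reg_obj.
have -> : X - 2^-1 *: (A + B) = 2^-1 *: ((X - A) + (X - B)).
  by apply/matrixP => i j; rewrite !mxE; field.
have BA0 : 2^-1 *: ((X - A) - (X - B)) <> 0.
  move=> /eqP; rewrite scaler_eq0 invr_eq0 pnatr_eq0 /= => /eqP e; apply: AB.
  by apply/matrixP => i j; move/matrixP/(_ i j): e; rewrite !mxE; lra.
have := frob2_gt0 BA0; rewrite (frob2_midpoint (X - A) (X - B)).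
have l0 : 0 <= (1 - p) / p by rewrite divr_ge0 ?subr_ge0 ?ltW.
have le2 : nuclear (2^-1 *: (A + B)) ^+ 2 <= (nuclear A ^+ 2 + nuclear B ^+ 2) / 2.
  have h := nuclear_midpoint_le A B; have h0 := nuclear_ge0 (2^-1 *: (A + B)).
  have : nuclear (2^-1 *: (A + B)) ^+ 2 <= ((nuclear A + nuclear B) / 2) ^+ 2.
    by rewrite lerXn2r ?nnegrE // (le_trans h0 h).
  have := sqr_ge0 (nuclear A - nuclear B); lra.
have := ler_wpM2l l0 le2; lra.
Qed.

Theorem theorem3 (R : realType) (m n : nat) (X : 'M[R]_(m, n)) (p : R)
  (hp0 : 0 < p) (hp1 : p < 1)
  (dopt : nat) (Uopt : 'M[R]_(m, dopt)) (Vopt : 'M[R]_(n, dopt))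
  (hdopt : (0 < dopt)%N)
  (hopt : forall (d : nat) (U : 'M[R]_(m, d)) (V : 'M[R]_(n, d)),
      (0 < d)%N -> dropout_obj p X Uopt Vopt <= dropout_obj p X U V) :
  forall A : 'M[R]_(m, n), A <> Uopt *m Vopt^T ->
    reg_obj p X (Uopt *m Vopt^T) < reg_obj p X A.
Proof.
move=> A neqA; set B := Uopt *m Vopt^T in neqA *.
(* The regularized value at [B] is at most the dropout optimum, hence at most the dropout value at a
   balanced factorization of [C], which is the regularized value at [C]. *)
have minB C : reg_obj p X B <= reg_obj p X C.
  have [d [U [V [d0 <-]]]] := dropout_obj_balanced X C hp0 hp1.
  exact: le_trans (reg_obj_le_dropout _ _ _ hp0 hp1) (hopt _ _ _ d0).
(* Minimality of [B] against the midpoint of [A] and [B] puts its value strictly below the average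
   of the two values, hence below that of [A]. *)
have := le_lt_trans (minB _) (reg_obj_midpoint_lt X hp0 hp1 neqA); lra.
Qed.
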